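(* Let $\ell \geq 1$ and $q \geq 1$ be integers. In the CONGEST model, any algorithm distinguishing between graphs of diameter $2\ell + q$ and graphs of diameter $3\ell+q$ requires $\Omega\bigl(n/((\ell+q)\log^3 n)\bigr)$ rounds, where $n$ is the number of vertices of the graph.
   Context: CONGEST model: the network is an unweighted, undirected connected graph on $n$ vertices; the vertices are processors with unlimited local computational power that initially know only their local neighborhood (and $n$). Computation proceeds in synchronous rounds; in each round every vertex can send to each of its neighbors a (possibly different) message of size $O(\log n)$ bits. The complexity of an algorithm is its worst-case number of rounds. An algorithm distinguishes between graphs of diameter $a$ and graphs of diameter $b$ if, when run on a network that is promised to have diameter either $a$ or $b$, the vertices output which of the two cases holds (deterministically, or with bounded error probability, e.g. at most $1/3$). The $\Omega(\cdot)$ is asymptotic in $n$, with a hidden constant independent of $\ell$, $q$ and $n$ (it may depend on the constant in the message-size bound). Known fact that may be used: in two-party communication complexity, any protocol (deterministic or bounded-error randomized) deciding whether $x,y\in\{0,1\}^N$, held by Alice and Bob respectively, have an index $k$ with $x[k]=y[k]=1$ (set disjointness) requires exchanging $\Omega(N)$ bits. *)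

(* Defs.v *)
From mathcomp Require Import all_boot all_order all_algebra.
From mathcomp Require Import all_classical all_reals all_analysis.

Set Implicit Arguments.
Unset Strict Implicit.
Unset Printing Implicit Defensive.

Import Order.TTheory GRing.Theory Num.Theory.
Local Open Scope classical_set_scope.
Local Open Scope ring_scope.

(* Random objects below (seeds, protocols) take values in arbitrary types with
   no sigma-algebra, so "E holds with probability at least p" is witnessed by a
   measurable subset of E; for measurable E this is just p <= P E. *)
Definition holds_with_prob d (Omega : measurableType d) (R : realType)
    (P : probability Omega R) (p : R) (E : set Omega) : Prop :=
  exists F : set Omega, [/\ measurable F, F `<=` E & (p%:E <= P F)%E].

(** * Networks *)

(* Vertices are 'I_n, and a vertex is its own identifier; n = 0 is harmless, as
   the empty graph has diameter 0. *)
Record network (n : nat) := Network {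
  adj : rel 'I_n;
  adj_sym : symmetric adj;
  adj_irr : irreflexive adj;
  adj_conn : forall u v : 'I_n, connect adj u v }.

Definition neighbors n (G : network n) (v : 'I_n) : {set 'I_n} :=
  [set w | adj G v w]%SET.

(* The least number of edges of a walk from u to v. In a connected graph this
   is less than n, so the search never falls off the end of the list. *)
Definition distance n (G : network n) (u v : 'I_n) : nat :=
  find (fun k => [exists p : k.-tuple 'I_n, path (adj G) u p && (last u p == v)])
       (iota 0 n).

Definition diameter n (G : network n) : nat :=
  (\max_(u : 'I_n) \max_(v : 'I_n) distance G u v)%N.

(** * The CONGEST model *)

(* An algorithm for n-vertex networks with messages of at most b bits. Local
   computation is unbounded: the state of a vertex ranges over an arbitrary
   type and the local functions are arbitrary. A vertex starts from its
   identifier, the identifiers of its neighbors and its random seed. [recv]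
   gets the message from each neighbor, and [None] from every other vertex. *)
Record algorithm (n b : nat) := Algorithm {
  seed : Type;
  state : Type;
  init : 'I_n -> {set 'I_n} -> seed -> state;
  send : state -> 'I_n -> {bseq b of bool};
  recv : state -> ('I_n -> option {bseq b of bool}) -> state;
  output : state -> bool }.

Definition round n b (A : algorithm n b) (G : network n)
    (s : 'I_n -> state A) : 'I_n -> state A :=
  fun v => recv (s v)
    (fun u => if u \in neighbors G v then Some (send (s u) v) else None).

Definition exec n b (A : algorithm n b) (G : network n) (r : 'I_n -> seed A)
    (T : nat) : 'I_n -> state A :=
  iter T (round G) (fun v => init v (neighbors G v) (r v)).

(* On every network of diameter D1 or D2, after T rounds, with probability at
   least 1 - eps, all vertices output whether the diameter is D1. The joint law
   of the seeds is arbitrary: independent seeds are private coins, equal seeds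
   are shared coins, and a constant r gives a deterministic algorithm. *)
Definition distinguishes d (Omega : measurableType d) (R : realType)
    (P : probability Omega R) n b (A : algorithm n b)
    (r : Omega -> 'I_n -> seed A) (T D1 D2 : nat) (eps : R) : Prop :=
  forall G : network n, diameter G = D1 \/ diameter G = D2 ->
    holds_with_prob P (1 - eps)
      [set w | forall v : 'I_n,
                 output (exec G (r w) T v) = (diameter G == D1)].

(** * Two-party communication *)

(* Alice holds x : X and Bob y : Y; an internal node is one bit sent by its
   owner. *)
Inductive protocol (X Y : Type) : Type :=
| Answer of bool
| Alice of X -> bool & protocol X Y & protocol X Y
| Bob of Y -> bool & protocol X Y & protocol X Y.

Fixpoint run X Y (p : protocol X Y) (x : X) (y : Y) : bool :=
  match p with
  | Answer a => a
  | Alice f p1 p0 => if f x then run p1 x y else run p0 x y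
  | Bob g p1 p0 => if g y then run p1 x y else run p0 x y
  end.

Fixpoint cost X Y (p : protocol X Y) : nat :=
  match p with
  | Answer _ => 0%N
  | Alice _ p1 p0 | Bob _ p1 p0 => (maxn (cost p1) (cost p0)).+1
  end.

Definition intersect N (x y : {ffun 'I_N -> bool}) : bool :=
  [exists k : 'I_N, x k && y k].

(* The Omega(N) bound for set disjointness, for protocols whose error
   probability is at most a constant eps < 1/2 on every input. *)
Definition disjointness_lower_bound (R : realType) : Prop :=
  forall eps : R, eps < 2^-1 ->
  exists2 c : R, 0 < c & exists N0 : nat,
  forall (N k : nat) (d : measure_display) (Omega : measurableType d)
         (P : probability Omega R)
         (p : Omega -> protocol {ffun 'I_N -> bool} {ffun 'I_N -> bool}),
    (N0 <= N)%N ->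
    (forall w, (cost (p w) <= k)%N) ->
    (forall x y, holds_with_prob P (1 - eps)
                   [set w | run (p w) x y = intersect x y]) ->
    c * N%:R <= k%:R.

(* Main.v *)
Require Import Defs.
From mathcomp Require Import all_boot all_order all_algebra.
From mathcomp Require Import all_classical all_reals all_analysis.
From mathcomp Require Import zify ring lra.

Set Implicit Arguments.
Unset Strict Implicit.
Unset Printing Implicit Defensive.

(* Let two families of coordinate sets be given, one on Alice's side and one on
   Bob's side, such that any two sets on the same side meet. Each set is the
   center of a star with a free leg of length about l/2, and is joined to the
   coordinates it contains by paths of length about l/2; the two copies of a
   coordinate are joined by a path of length q, and switching between two
   coordinates on the same side costs l. Going from the tip of a free leg on
   Alice's side to one on Bob's side costs l + q + l if the two sets meet and
   3l + q if they are disjoint, and this decides the diameter. A disjointness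
   instance of size N is encoded by O(log N) coordinates, so the two sides are
   joined by O(log N) paths only, and a T-round algorithm yields a protocol with
   O(T b log N) bits on a graph with O(N (l + q) log N) vertices. *)

(** * Distances *)

Section Distance.
Variables (n : nat) (G : network n).

Lemma distance_le_walk (u : 'I_n) (p : seq 'I_n) :
  path (adj G) u p -> distance G u (last u p) <= size p.
Proof.
move=> pathp; rewrite /distance.
have [le_n_p|lt_p_n] := leqP n (size p).
  by apply: leq_trans le_n_p; rewrite -[leqRHS](size_iota 0) find_size.
rewrite leqNgt; apply/negP => /(before_find 0).
rewrite nth_iota // add0n => /existsP; apply.
by exists (in_tuple p); rewrite pathp eqxx.
Qed.

(** A walk without repeated vertices has fewer than [n] edges, so the bounded search in [distance]
    succeeds. *)
Lemma distance_walk (u v : 'I_n) :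
  exists p, [/\ path (adj G) u p, last u p = v & size p = distance G u v].
Proof.
have /connectP[p pathp ->] := adj_conn G u v.
case/shortenP: pathp => s paths uniqs _ {p}.
set P := fun k => [exists p : k.-tuple 'I_n,
                     path (adj G) u p && (last u p == last u s)].
have hasP : has P (iota 0 n).
  have lt_s_n : size s < n.
    by rewrite -[n in _ < n]card_ord -[(size s).+1]/(size (u :: s))
      -(card_uniqP uniqs) max_card.
  apply/hasP; exists (size s); first by rewrite mem_iota.
  by apply/existsP; exists (in_tuple s); rewrite paths eqxx.
have := nth_find 0 hasP.
have := hasP; rewrite has_find size_iota => lt_n; rewrite nth_iota //.
rewrite add0n => /existsP[t /andP[patht /eqP lastt]].
by exists t; rewrite size_tuple.
Qed.

(** Every lower bound on a diameter goes through such a potential, which avoids reasoning on the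
    shape of walks. *)
Lemma distance_lipschitz (phi : 'I_n -> nat) :
    (forall u v, adj G u v -> phi v <= (phi u).+1) ->
  forall u v, phi v <= phi u + distance G u v.
Proof.
move=> philip u v; have [p [pathp <- <-]] := distance_walk u v.
elim: p u pathp {v} => [|w p IHp] u /=; first by rewrite addn0.
by case/andP=> /philip + /IHp; lia.
Qed.

Lemma diameter_leP (m : nat) :
  reflect (forall u v, distance G u v <= m) (diameter G <= m).
Proof.
apply: (iffP (bigop.bigmax_leqP _ _ _)) => [le_m u v|le_m u _].
  exact: leq_trans (leq_bigmax v) (le_m u isT).
by apply/bigop.bigmax_leqP => v _.
Qed.

Lemma distance_le_diameter (u v : 'I_n) : distance G u v <= diameter G.
Proof. by move: u v; apply/diameter_leP. Qed.

End Distance.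

(** * Walks of bounded length over a possibly infinite vertex type *)

Section Walks.
Variables (V : Type) (e : rel V).

Inductive walk : nat -> V -> V -> Prop :=
| walk_nil u : walk 0 u u
| walk_cons k u w v : e u w -> walk k w v -> walk k.+1 u v.

Lemma walk0_inv (u v : V) : walk 0 u v -> u = v.
Proof. by move=> uv; inversion uv. Qed.

Lemma walkS_inv (k : nat) (u v : V) :
  walk k.+1 u v -> exists2 w, e u w & walk k w v.
Proof. by move=> uv; inversion uv as [|? ? w]; exists w. Qed.

Definition dist_le (k : nat) (u v : V) : Prop := exists2 j, j <= k & walk j u v.

Lemma dist_le_refl (k : nat) (u : V) : dist_le k u u.
Proof. by exists 0 => //; exact: walk_nil. Qed.

Lemma dist_le_edge (u v : V) : e u v -> dist_le 1 u v.
Proof. by move=> uv; exists 1 => //; apply: walk_cons uv (walk_nil _). Qed.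

Lemma dist_le_trans (v u w : V) (j k : nat) :
  dist_le j u v -> dist_le k v w -> dist_le (j + k) u w.
Proof.
case=> j' jj' uv [k' kk' vw]; exists (j' + k'); first lia.
elim: uv vw {jj' kk'} => // i x y z xy _ IH /IH; exact: walk_cons.
Qed.

Lemma dist_le_weaken (k j : nat) (u v : V) :
  dist_le j u v -> j <= k -> dist_le k u v.
Proof. by case=> i ij uv jk; exists i => //; apply: leq_trans jk. Qed.

Lemma dist_le_sym (k : nat) (u v : V) : symmetric e ->
  dist_le k u v -> dist_le k v u.
Proof.
move=> syme [j + uv]; elim: uv k => {j u v} [u|j u w v uw _ IH] k jk.
  exact: dist_le_refl.
have {}IH := IH k.-1 ltac:(lia).
apply: (@dist_le_weaken _ (k.-1 + 1)); last lia.
by apply: dist_le_trans IH _; apply: dist_le_edge; rewrite syme.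
Qed.

End Walks.

(** * Blow-ups *)

(* Padding device: the fibres of [f] are sets of twins, so one small graph
   yields networks on every large enough number of vertices. *)
Section Blowup.
Variables (V : Type) (e : rel V) (valid : V -> Prop) (n : nat) (f : 'I_n -> V).
Hypothesis syme : symmetric e.
Hypothesis irre : irreflexive e.
Hypothesis valid_edge : forall u v, e u v -> valid v.
Hypothesis f_valid : forall v, valid (f v).
Hypothesis f_onto : forall x, valid x -> exists v, f v = x.
Hypothesis no_isolated : forall x, valid x -> exists y, e x y.
Variable D : nat.
Hypothesis D_ge2 : 2 <= D.
Hypothesis dist_leD : forall x y, valid x -> valid y -> dist_le e D x y.

Definition blowup_rel : rel 'I_n := fun u v => e (f u) (f v).

(** The last step of a lifted walk may end at any twin; an empty walk has no such freedom, hence the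
    positive length. *)
Lemma blowup_walk (k : nat) (u v : 'I_n) : walk e k.+1 (f u) (f v) ->
  exists p, [/\ path blowup_rel u p, last u p = v & size p = k.+1].
Proof.
elim: k u => [|k IH] u walkuv; have [w uw wv] := walkS_inv walkuv.
  have fw := walk0_inv wv; by subst w; exists [:: v]; rewrite /= /blowup_rel uw.
have [w' fw'] := f_onto (valid_edge uw).
rewrite -fw' in uw wv.
have [p [pathp lastp sizep]] := IH _ wv.
by exists (w' :: p); rewrite /= pathp sizep /blowup_rel uw.
Qed.

(** Twins are joined by a walk of length 2 through a common neighbor; this is where [D_ge2] and
    [no_isolated] enter. *)
Lemma blowup_dist_le (u v : 'I_n) :
  exists p, [/\ path blowup_rel u p, last u p = v & size p <= D].
Proof.
have [k kD walkuv] := dist_leD (f_valid u) (f_valid v).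
case: k kD walkuv => [|k] kD walkuv; last first.
  by have [p [? ? sizep]] := blowup_walk walkuv; exists p; rewrite sizep.
have fuv := walk0_inv walkuv.
have [y xy] := no_isolated (f_valid u).
have [w fw] := f_onto (valid_edge xy).
by exists [:: w; v]; rewrite /= /blowup_rel fw xy -fuv syme xy.
Qed.

Lemma blowup_sym : symmetric blowup_rel.
Proof. by move=> u v; exact: syme. Qed.

Lemma blowup_irr : irreflexive blowup_rel.
Proof. by move=> u; exact: irre. Qed.

Lemma blowup_conn (u v : 'I_n) : connect blowup_rel u v.
Proof. by have [p [? <- _]] := blowup_dist_le u v; apply/connectP; exists p. Qed.

Definition blowup : network n := Network blowup_sym blowup_irr blowup_conn.

Lemma diameter_blowup_le : diameter blowup <= D.
Proof.
apply/diameter_leP => u v; have [p [pathp <- sizep]] := blowup_dist_le u v.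
exact: leq_trans (@distance_le_walk _ blowup u p pathp) sizep.
Qed.

Lemma diameter_blowup_ge (phi : V -> nat) (x y : V) :
    (forall x y, valid x -> e x y -> phi y <= (phi x).+1) ->
    valid x -> valid y -> phi y <= phi x + diameter blowup.
Proof.
move=> philip /f_onto[u <-] /f_onto[v <-].
apply: leq_trans (leq_add (leqnn _) (@distance_le_diameter _ blowup u v)).
apply: (@distance_lipschitz _ blowup (phi \o f)) => u' v' /=.
exact/philip/f_valid.
Qed.

End Blowup.

(** * The gap graph *)

(* [Line k x] is the point at position [x] of a path of length [2g + q], one
   for each coordinate [k]; its coordinate vertices are at positions [g] (on
   Alice's side, [false]) and [g + q] (on Bob's side, [true]). [Star s i o t] is
   the point at distance [t] from the center of the [i]-th star on side [s], on
   the leg [o]. The leg [None] is free: it is never attached to a coordinate. The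
   points [Star s i o 0] all represent the center: they are twins. *)
Inductive vertex (I K : Type) :=
| Star of bool & I & option K & nat
| Line of K & nat
| Hub of bool.
Arguments Line {I K}.
Arguments Hub {I K}.

Section GapGraph.
Variables (I K : finType) (g q : nat) (ev : bool) (S : bool -> I -> {set K}).
Hypothesis q_gt0 : 0 < q.

Local Notation V := (vertex I K).
(* [ev] is the parity bit of [l]: [l] is even iff [ev] holds. *)
Local Notation l := (g.*2.+1 + ev).

Definition coord_pos (s : bool) : nat := if s then g + q else g.
Definition hub_pos (s : bool) : nat := if s then g + q + g else 0.
Local Notation coord s k := (Line k (coord_pos s) : V).

Definition valid (u : V) : bool :=
  match u with
  | Star _ _ _ t => t <= g + ev
  | Line _ x => x <= g + q + g
  | Hub _ => true
  end.

(* A switch between two coordinates on the same side costs [l]: through the hub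
   if [l] is even, through the clique on the end points of the lines if [l] is
   odd. *)
Definition arc (u v : V) : bool :=
  match u, v with
  | Star s i o t, Star s' i' o' t' =>
      [&& s == s', i == i', t' == t.+1 & (t == 0) || (o == o')]
  | Star s i o t, Line k x =>
      [&& k \in S s i, t == g, x == coord_pos s & (t == 0) || (o == Some k)]
  | Line k x, Line k' x' =>
      (k == k') && (x' == x.+1) ||
      [&& ~~ ev, k != k', x == x' & (x == hub_pos false) || (x == hub_pos true)]
  | Hub s, Line k x => x == hub_pos s
  | _, _ => false
  end.

Definition edge (u v : V) : bool := [&& valid u, valid v & arc u v || arc v u].

Lemma edge_sym : symmetric edge.
Proof. by move=> u v; rewrite /edge orbC andbCA. Qed.

Lemma edge_irr : irreflexive edge.
Proof.
move=> [s i o t|k x|s] //; rewrite /edge orbb /=.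
  by rewrite (ltn_eqF (ltnSn t)) !andbF.
by rewrite (ltn_eqF (ltnSn x)) eqxx !andbF.
Qed.

Lemma edge_valid (u v : V) : edge u v -> valid v.
Proof. by case/and3P. Qed.

Local Notation dle := (dist_le edge).

(** With truncated subtraction, [x - y + (y - x)] is the absolute difference. *)
Lemma line_dist_le (k : K) (x y : nat) : x <= g + q + g -> y <= g + q + g ->
  dle (x - y + (y - x)) (Line k x) (Line k y).
Proof.
wlog xy : x y / x <= y => [H xn yn|_ yn].
  have [xy|yx] := leqP x y; first exact: H.
  by rewrite addnC; apply: dist_le_sym edge_sym _; apply: H => //; exact: ltnW.
rewrite -(subnKC xy); move: (y - x) (subnKC xy) => d yE.
have {yE yn xy} : x + d <= g + q + g by rewrite yE.
have -> : x - (x + d) + (x + d - x) = d by lia.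
elim: d => [|d IH] xd; first by rewrite addn0; exact: dist_le_refl.
rewrite -[in dle _]addn1; apply: dist_le_trans (IH _) _; first lia.
by apply: dist_le_edge; rewrite /edge /= addnS !eqxx /= andbT; lia.
Qed.

Lemma star_center (s : bool) (i : I) (o : option K) (t : nat) : t <= g + ev ->
  dle t (Star s i o 0) (Star s i o t).
Proof.
elim: t => [|t IH] tg; first exact: dist_le_refl.
rewrite -addn1; apply: dist_le_trans (IH _) _; first lia.
by apply: dist_le_edge; rewrite /edge /= !eqxx /= orbT; apply/and3P; split; lia.
Qed.

Lemma center_coord (s : bool) (i : I) (o : option K) (k : K) : k \in S s i ->
  dle g.+1 (Star s i o 0) (coord s k).
Proof.
move=> kS; have pos : coord_pos s <= g + q + g by case: s {kS} => /=; lia.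
(* For [g = 0] the center itself is attached to the coordinate, whatever its label [o]; otherwise
   the walk follows the leg [Some k]. *)
suff H : dle g (Star s i o 0) (Star s i (if g == 0 then o else Some k) g).
  rewrite -addn1; apply: dist_le_trans H _; apply: dist_le_edge.
  rewrite /edge /= kS !eqxx pos /=; by case: eqP => _;
    rewrite /= ?eqxx /= andbT; lia.
have H t : 0 < t -> t <= g + ev -> dle t (Star s i o 0) (Star s i (Some k) t).
  elim: t => // t IH _ tg; have [->|t0] := posnP t.
    by apply: dist_le_edge; rewrite /edge /= !eqxx /=; lia.
  rewrite -addn1; apply: dist_le_trans (IH _ _) _ => //; first lia.
  by apply: dist_le_edge; rewrite addn1 /edge /= !eqxx orbT /=; lia.
have [g0|g_gt0] := posnP g; first by rewrite g0; exact: dist_le_refl.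
by apply: H => //; lia.
Qed.

Lemma star_coord (s : bool) (i : I) (o : option K) (t : nat) (k : K) :
  t <= g + ev -> k \in S s i -> dle l (Star s i o t) (coord s k).
Proof.
move=> tg kS; apply: (@dist_le_weaken _ _ _ (t + g.+1)); last lia.
apply: dist_le_trans (center_coord _ kS).
exact/(dist_le_sym edge_sym)/star_center.
Qed.

Lemma hub_pos_le (s : bool) : hub_pos s <= g + q + g.
Proof. by case: s => /=; lia. Qed.

Lemma hub_line (s : bool) (k : K) : dle 1 (Hub s) (Line k (hub_pos s)).
Proof. by apply: dist_le_edge; rewrite /edge /= hub_pos_le eqxx. Qed.

Lemma end_coord (s : bool) (k : K) : dle g (Line k (hub_pos s)) (coord s k).
Proof.
apply: dist_le_weaken (line_dist_le _ (hub_pos_le s) _) _;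
  by case: s => /=; lia.
Qed.

Lemma end_switch (s : bool) (k k' : K) :
  dle ev.+1 (Line k (hub_pos s)) (Line k' (hub_pos s)).
Proof.
have [->|kk'] := eqVneq k k'; first exact: dist_le_refl.
case evE : ev.
  apply: (@dist_le_trans _ _ (Hub s) _ _ 1 1); last exact: hub_line.
  exact/(dist_le_sym edge_sym)/hub_line.
apply: dist_le_edge; rewrite /edge /= hub_pos_le kk' evE eqxx /=.
by case: s; rewrite eqxx ?orbT.
Qed.

(* The points on neither side are the inner points of the paths of length [q]. *)
Definition inside (s : bool) (u : V) : bool :=
  match u with
  | Star s' _ _ _ => s == s'
  | Line k x => if s then g + q <= x else x <= g
  | Hub s' => s == s'
  end.

(* Only meaningful for points [u] on side [s]. *)
Definition trace (s : bool) (u : V) : {set K} :=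
  if u is Star _ i _ _ then S s i else [set: K]%SET.

(** A star pays at most [g + ev] to its center and [g + 1] from there. A point of a line walks
    outward to the end, switches and comes back, for at most [g + (ev + 1) + g = l]; so it reaches
    every coordinate of its side. *)
Lemma trace_coord (s : bool) (u : V) (k : K) :
  valid u -> inside s u -> k \in trace s u -> dle l u (coord s k).
Proof.
case: u => [s' i o t|k' x|s'] /= validu.
- by move/eqP <-; exact: star_coord.
- move=> xs _.
  apply: (@dist_le_weaken _ _ _ (g + ev.+1 + g)); last lia.
  apply: dist_le_trans (end_coord s k).
  apply: dist_le_trans (end_switch s k' k).
  by apply: dist_le_weaken (line_dist_le _ validu (hub_pos_le s)) _;
    case: s xs => /=; lia.
- move/eqP<- => _; apply: (@dist_le_weaken _ _ _ (1 + g)); last lia.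
  exact: dist_le_trans (hub_line s k) (end_coord s k).
Qed.

Lemma coord_switch (s : bool) (k k' : K) : dle l (coord s k) (coord s k').
Proof.
apply: trace_coord; rewrite /= ?finset.in_setT //; case: (s) => //=; lia.
Qed.

Lemma coord_cross (k : K) : dle q (coord false k) (coord true k).
Proof. by apply: dist_le_weaken (line_dist_le _ _ _) _ => /=; lia. Qed.

(** * Upper bounds on distances in the gap graph *)

Section UpperBound.
Hypothesis S_meet : forall s i i', exists k, k \in S s i :&: S s i'.
Variable k0 : K.

Lemma trace_meet (s s' : bool) (u v : V) :
    (forall i j, exists k, k \in S s i :&: S s' j) ->
  exists2 k, k \in trace s u & k \in trace s' v.
Proof.
move=> meet; case: u => [s1 i o t|k1 x|s1]; case: v => [s2 j o' t'|k2 x'|s2] /=;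
  try by [exists k0; rewrite finset.in_setT];
  try by [have [k /setIP[]] := meet i i; exists k; rewrite ?finset.in_setT];
  try by [have [k /setIP[]] := meet j j; exists k; rewrite ?finset.in_setT].
by have [k /setIP[]] := meet i j; exists k.
Qed.

Lemma inside_or_mid (u : V) : valid u ->
  (exists s, inside s u) \/ exists k x, u = Line k x /\ g <= x <= g + q.
Proof.
case: u => [s i o t|k x|s] /= validu; [by left; exists s| |by left; exists s].
have [xg|xg] := leqP x g; first by left; exists false.
have [xgq|xgq] := leqP (g + q) x; first by left; exists true.
by right; exists k, x; split => //; lia.
Qed.

Lemma dist_le_same_side (s : bool) (u v : V) : valid u -> valid v ->
  inside s u -> inside s v -> dle (l + l) u v.
Proof.
move=> validu validv su sv; have [k ku kv] := trace_meet u v (S_meet s).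
apply: dist_le_trans (trace_coord validu su ku) _.
exact/(dist_le_sym edge_sym)/trace_coord.
Qed.

Lemma dist_le_mid (s : bool) (u : V) (k : K) (x : nat) :
  valid u -> inside s u -> g <= x <= g + q -> dle (2 * l + q) u (Line k x).
Proof.
move=> validu su xg; have [k' k'u _] := trace_meet u u (S_meet s).
apply: (@dist_le_weaken _ _ _ (l + l + q)); last lia.
apply: (@dist_le_trans _ _ (coord s k)).
  exact: dist_le_trans (trace_coord validu su k'u) (coord_switch s k' k).
by apply: dist_le_weaken (line_dist_le _ _ _) _; case: (s); rewrite /=; lia.
Qed.

(** The detours through the two sides have total length [2 * (l + q)], so the shorter one is at most
    [l + q]. *)
Lemma dist_le_mid_mid (k k' : K) (x x' : nat) :
    g <= x <= g + q -> g <= x' <= g + q ->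
  dle (2 * l + q) (Line k x) (Line k' x').
Proof.
move=> xg x'g.
have H s : dle ((x - coord_pos s + (coord_pos s - x)) + l +
    (coord_pos s - x' + (x' - coord_pos s))) (Line k x) (Line k' x').
  apply: (@dist_le_trans _ _ (coord s k')).
    apply: (@dist_le_trans _ _ (coord s k)); last exact: coord_switch.
    by apply: line_dist_le; case: s; rewrite /=; lia.
  by apply: line_dist_le; case: s; rewrite /=; lia.
have [le|le] := leqP (x + x') (g + g + q).
  by apply: dist_le_weaken (H false) _; rewrite /=; lia.
by apply: dist_le_weaken (H true) _; rewrite /=; lia.
Qed.

(** Only a crossing between the sides can exceed [2 * l + q]: without a common coordinate, one more
    switch on Bob's side is paid. *)
Lemma dist_le_gap (D : nat) (u v : V) : 2 * l + q <= D ->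
    (forall i j, exists k, k \in S false i :&: S true j) \/ 3 * l + q <= D ->
  valid u -> valid v -> dle D u v.
Proof.
move=> leD cross validu validv.
have H u' v' : valid u' -> valid v' -> inside false u' -> inside true v' ->
    dle D u' v'.
  move=> validu' validv' su sv.
  have [[k ku kv]|le3D] :
      (exists2 k, k \in trace false u' & k \in trace true v') \/ 3 * l + q <= D.
    by case: cross => [cross|]; [left; exact: trace_meet|right].
  - apply: (@dist_le_weaken _ _ _ (l + q + l)); last lia.
    apply: dist_le_trans (dist_le_sym edge_sym (trace_coord validv' sv kv)).
    exact: dist_le_trans (trace_coord validu' su ku) (coord_cross k).
  - have [k ku _] := trace_meet u' u' (S_meet false).
    have [k' kv _] := trace_meet v' v' (S_meet true).
    apply: (@dist_le_weaken _ _ _ (l + q + l + l)); last lia.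
    apply: dist_le_trans (dist_le_sym edge_sym (trace_coord validv' sv kv)).
    apply: dist_le_trans (coord_switch true k k').
    exact: dist_le_trans (trace_coord validu' su ku) (coord_cross k).
have [[s su]|[k [x [-> xg]]]] := inside_or_mid validu;
  have [[s' sv]|[k' [x' [-> x'g]]]] := inside_or_mid validv.
- case: s s' su sv => [] [] su sv; try by [exact: H];
    try by apply/(dist_le_sym edge_sym)/H.
  + by apply: dist_le_weaken (dist_le_same_side validu validv su sv) _; lia.
  + by apply: dist_le_weaken (dist_le_same_side validu validv su sv) _; lia.
- exact: dist_le_weaken (dist_le_mid k' validu su x'g) leD.
- apply: (dist_le_sym edge_sym).
  exact: dist_le_weaken (dist_le_mid k validv sv xg) leD.
- exact: dist_le_weaken (dist_le_mid_mid k k' xg x'g) leD.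
Qed.

End UpperBound.

(** * Lower bounds on distances by potentials *)

Lemma edge_lipschitz (phi : V -> nat) :
    (forall u v, valid u -> valid v -> arc u v ->
       phi v <= (phi u).+1 /\ phi u <= (phi v).+1) ->
  forall u v, valid u -> edge u v -> phi v <= (phi u).+1.
Proof.
by move=> H u v _ /and3P[vu vv /orP[]] /H; [case/(_ vu vv)|case/(_ vv vu)].
Qed.

(** It rises from 0 at the free tips on Alice's side to [2 * l + q] at those on Bob's side. It
    ignores [S], so it serves every pair of stars. *)
Definition near_potential (u : V) : nat :=
  match u with
  | Star false _ None t => g + ev - t
  | Star false _ (Some _) t => g + ev + t
  | Star true _ None t => l + q + g.+1 + t
  | Star true _ (Some _) t => l + q + g.+1 - t
  | Line _ x => l + minn (x - g) q
  | Hub s => if s then l + q else l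
  end.

Lemma near_potential_lipschitz (u v : V) : valid u -> edge u v ->
  near_potential v <= (near_potential u).+1.
Proof.
apply: edge_lipschitz => {u v} [] [s i o t|k x|s] [s' i' o' t'|k' x'|s'] //=.
- move=> tg t'g /and4P[/eqP<- _ /eqP->].
  by case/orP => [/eqP->|/eqP->]; case: s; case: o; case: o' => *; lia.
- move=> tg xg /and4P[_ /eqP-> /eqP-> ].
  by case/orP => [/eqP g0|/eqP->]; case: s; case: o => * /=; lia.
- by move=> xg x'g /orP[/andP[_ /eqP->]|/and4P[_ _ /eqP-> _]]; lia.
- by move=> _ xg /eqP->; case: s => /=; lia.
Qed.

(* If the two sets are disjoint, a walk from the star [i0] to the star [j0] enters
   the coordinates in [S false i0], leaves from those in [S true j0], and has to
   switch in between. *)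
Definition far_potential (i0 j0 : I) (u : V) : nat :=
  match u with
  | Star s i o t =>
      if ~~ s && (i == i0) then (if o is None then g + ev - t else g + ev + t)
      else if s && (i == j0) then
        (if o is None then 2 * l + q + g.+1 + t else 2 * l + q + g.+1 - t)
      else (if s then q else 0) + l +
        (if o is Some k then
           if k \in S false i0 then g.+1 - t else g.+1 + t
         else g.+1)
  | Line k x => minn (x - g) q +
      (if k \in S false i0 then l + ((g - x) + (x - (g + q)))
       else 2 * l - ((g - x) + (x - (g + q))))
  | Hub s => (if s then q else 0) + l + g.+1
  end.

(** At the end of a line the level, up to the shift [q] on Bob's side, is [l + g] for a coordinate
    in [S false i0] and [2 * l - g] otherwise. The difference [ev + 1] is the price of a switch, and
    the hub, at [l + g + 1], is within 1 of both. *)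
Lemma far_potential_lipschitz (i0 j0 : I) (u v : V) :
    [disjoint S false i0 & S true j0] -> valid u -> edge u v ->
  far_potential i0 j0 v <= (far_potential i0 j0 u).+1.
Proof.
move=> orth.
apply: edge_lipschitz => {u v} [] [s i o t|k x|s] [s' i' o' t'|k' x'|s'] //=.
- move=> tg t'g /and4P[/eqP<- /eqP<- /eqP->].
  case: ifP => [/andP[_ _]|_].
    by case/orP => [/eqP->|/eqP->]; case: o; case: o' => *; lia.
  case: ifP => [/andP[_ _]|_].
    by case/orP => [/eqP->|/eqP->]; case: o; case: o' => *; lia.
  case/orP => [/eqP->|/eqP->].
    by case: o; case: o' => *; do !case: ifP => _; lia.
  by case: o' => *; do !case: ifP => _; lia.
- move=> tg xg /and4P[kS /eqP-> /eqP->].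
  have [/andP[/negbTE sF /eqP ii0]|_] := boolP (~~ s && (i == i0)).
    rewrite sF ii0 in kS *; rewrite kS /=.
    by case/orP => [/eqP g0|/eqP->]; [case: o => *|]; lia.
  have [/andP[sT /eqP ij0]|_] := boolP (s && (i == j0)).
    rewrite sT ij0 in kS *.
    (* A coordinate of [j0] lies outside [S false i0], so its level is [2 * l + q]. *)
    rewrite (disjointFl orth kS) /=.
    by case/orP => [/eqP g0|/eqP->]; [case: o => *|]; lia.
  case/orP => [/eqP g0|/eqP->].
    by case: s {kS}; case: o => *; rewrite /=; do !case: ifP => _; lia.
  by case: s {kS}; rewrite /=; do !case: ifP => _; lia.
- move=> xg x'g /orP[/andP[/eqP<- /eqP->]|].
    by case: ifP => _; lia.
  by case/and4P => /negbTE evF _ /eqP<- /orP[]/eqP->; do !case: ifP => _;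
    rewrite ?evF; lia.
- by move=> _ xg /eqP->; case: s; case: ifP => _ /=; lia.
Qed.

End GapGraph.

(** * Two-party simulation of CONGEST algorithms *)

Fixpoint flip (X Y : Type) (p : protocol X Y) : protocol Y X :=
  match p with
  | Answer a => Answer Y X a
  | Alice f p1 p0 => Bob f (flip p1) (flip p0)
  | Bob f p1 p0 => Alice f (flip p1) (flip p0)
  end.

Lemma run_flip (X Y : Type) (p : protocol X Y) (x : X) (y : Y) :
  run (flip p) y x = run p x y.
Proof. by elim: p => //= f p1 -> p0 ->. Qed.

Lemma cost_flip (X Y : Type) (p : protocol X Y) : cost (flip p) = cost p.
Proof. by elim: p => //= f p1 -> p0 ->. Qed.

Lemma card_split (M : finType) (D : {set M}) (a b : nat) : #|D| <= a + b ->
  exists2 E : {set M}, #|D :&: E| <= a & #|D :\: E| <= b.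
Proof.
move=> Dab; exists [set x in take a (enum D)]%SET.
  apply: leq_trans (_ : size (take a (enum D)) <= a).
    apply: leq_trans (card_size _); apply: subset_leq_card.
    by apply/fintype.subsetP => x; rewrite !inE => /andP[].
  by rewrite size_take_min geq_minl.
apply: leq_trans (_ : size (drop a (enum D)) <= b).
  apply: leq_trans (card_size _); apply: subset_leq_card.
  apply/fintype.subsetP => x; rewrite !inE => /andP[/negbTE xE].
  by rewrite -mem_enum -{1}(cat_take_drop a (enum D)) mem_cat xE.
by rewrite size_drop -cardE; lia.
Qed.

(** Binary search: each bit tells which half of the remaining candidates contains [F x]. *)
Lemma alice_sends (X Y : Type) (M : finType) (F : X -> M)
    (cont : M -> protocol X Y) (w c : nat) :
    #|M| <= 2 ^ w -> (forall m, cost (cont m) <= c) ->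
  exists2 p : protocol X Y, cost p <= w + c &
    forall x y, run p x y = run (cont (F x)) x y.
Proof.
move=> Mw contc; suff H (D : {set M}) : #|D| <= 2 ^ w ->
    exists2 p : protocol X Y, cost p <= w + c &
      forall x y, F x \in D -> run p x y = run (cont (F x)) x y.
  have [|p pc runp] := H [set: M]%SET; first by rewrite cardsT.
  by exists p => // x y; apply: runp; rewrite finset.in_setT.
elim: w D {Mw} => [|w IH] D.
  rewrite expn0 => /card_le1_eqP D1.
  have [->|[m Dm]] := set_0Vmem D.
    by exists (Answer X Y true) => // x y; rewrite inE.
  by exists (cont m) => [|x y FD]; rewrite ?(D1 _ _ Dm FD).
rewrite expnS mul2n -addnn => /card_split[E /IH[p1 c1 run1] /IH[p0 c0 run0]].
exists (Alice (fun x => F x \in E) p1 p0) => [|x y FD] /=; first lia.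
by case: ifP => FE; [apply: run1|apply: run0]; rewrite !inE ?FE ?FD.
Qed.

Lemma bob_sends (X Y : Type) (M : finType) (F : Y -> M)
    (cont : M -> protocol X Y) (w c : nat) :
    #|M| <= 2 ^ w -> (forall m, cost (cont m) <= c) ->
  exists2 p : protocol X Y, cost p <= w + c &
    forall x y, run p x y = run (cont (F y)) x y.
Proof.
move=> Mw contc.
have [|p pc runp] := alice_sends F (cont := fun m => flip (cont m)) Mw (c := c).
  by move=> m; rewrite cost_flip.
by exists (flip p) => [|x y]; rewrite ?cost_flip // run_flip runp run_flip.
Qed.

(** There are [2 ^ b.+1 - 1] bit strings of length at most [b]. *)
Lemma card_messages (K : finType) (b : nat) :
  #|{ffun K -> {bseq b of bool}}| <= 2 ^ (b.+1 * #|K|).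
Proof.
rewrite card_ffun expnM; have [->|K_gt0] := posnP #|K|; first by rewrite !expn0.
rewrite leq_exp2r //.
rewrite card_bseq (eq_bigr (fun i : 'I_b.+1 => 2 ^ i)) => [|i _].
  by have := predn_exp 2 b.+1; rewrite mul1n => <-; exact: leq_pred.
by rewrite card_bool.
Qed.

Section Simulation.
Variables (X Y : Type) (n b : nat) (A : algorithm n b) (out : state A -> bool).
Variables (G : X -> Y -> network n) (alice : pred 'I_n).
Variables (nbA : X -> 'I_n -> {set 'I_n}) (nbB : Y -> 'I_n -> {set 'I_n}).
Hypothesis nbAE : forall x y v, alice v -> neighbors (G x y) v = nbA x v.
Hypothesis nbBE : forall x y v, ~~ alice v -> neighbors (G x y) v = nbB y v.
Variables (K : finType) (cutA cutB : K -> 'I_n).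
Hypothesis cutE : forall x y u v, adj (G x y) u v -> alice u -> ~~ alice v ->
  exists k, u = cutA k /\ v = cutB k.

Definition outgoing (own other : K -> 'I_n) (s : 'I_n -> state A) :
    {ffun K -> {bseq b of bool}} :=
  [ffun k => send (s (own k)) (other k)].

(** The empty string is a dummy: by [cutE] the pick succeeds on every edge that crosses the cut. *)
Definition incoming (own other : K -> 'I_n) (m : {ffun K -> {bseq b of bool}})
    (u v : 'I_n) : {bseq b of bool} :=
  if [pick k | (other k == u) && (own k == v)] is Some k then m k
  else [bseq of [::]].

(** Several [k] may name the same pair, but they all carry the same message. *)
Lemma incoming_outgoing (own other : K -> 'I_n) (s : 'I_n -> state A) (k : K) :
  incoming own other (outgoing other own s) (other k) (own k)
  = send (s (other k)) (own k).
Proof.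
rewrite /incoming; case: pickP => [k' /andP[/eqP <- /eqP <-]|/(_ k)].
  by rewrite ffunE.
by rewrite !eqxx.
Qed.

(** A party also updates vertices it does not own, with meaningless results; only its own half is
    used when the two are glued. *)
Definition half_round (mine : pred 'I_n) (nb : 'I_n -> {set 'I_n})
    (inbox : 'I_n -> 'I_n -> {bseq b of bool}) (s : 'I_n -> state A) :
    'I_n -> state A :=
  fun v => recv (s v) (fun u => if u \in nb v then
    Some (if mine u then send (s u) v else inbox u v) else None).

Lemma simulation_step (x : X) (y : Y) (sA sB s : 'I_n -> state A) :
    (forall v, s v = if alice v then sA v else sB v) ->
  forall v, round (G x y) s v =
    if alice v then
      half_round alice (nbA x) (incoming cutA cutB (outgoing cutB cutA sB)) sA v
    else half_round (predC alice) (nbB y)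
      (incoming cutB cutA (outgoing cutA cutB sA)) sB v.
Proof.
move=> sE v; rewrite /round /half_round sE.
have nbG u : (u \in neighbors (G x y) v) = adj (G x y) v u by rewrite inE.
case: ifP => av; congr recv; apply/funext => u.
- rewrite -(nbAE _ y av) nbG; case: ifP => // vu; rewrite sE.
  case: ifPn => // au; have [k [-> ->]] := cutE vu av au.
  by rewrite incoming_outgoing.
- rewrite -(nbBE x _ (negbT av)) nbG; case: ifP => // vu; rewrite sE /=.
  case: ifPn => //= au; rewrite adj_sym in vu.
  have [k [-> ->]] := cutE vu au (negbT av).
  by rewrite incoming_outgoing.
Qed.

(** Arbitrary starting states let the induction restart after each round. Both messages of a round
    are computed from the states at its start; the final bit is Alice announcing the output of
    [v0]. *)
Lemma simulate (v0 : 'I_n) (T : nat) (sA : X -> 'I_n -> state A)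
    (sB : Y -> 'I_n -> state A) : alice v0 ->
  exists2 p : protocol X Y, cost p <= T * (2 * (b.+1 * #|K|)) + 1 &
    forall x y s, (forall v, s v = if alice v then sA x v else sB y v) ->
      run p x y = out (iter T (round (G x y)) s v0).
Proof.
move=> av0; elim: T sA sB => [|T IH] sA sB.
  exists (Alice (fun x => out (sA x v0)) (Answer X Y true) (Answer X Y false)).
    by [].
  by move=> x y s sE /=; rewrite sE av0; case: out.
pose sA' mB x := half_round alice (nbA x) (incoming cutA cutB mB) (sA x).
pose sB' mA y :=
  half_round (predC alice) (nbB y) (incoming cutB cutA mA) (sB y).
have /choice[p pP] (m : {ffun K -> {bseq b of bool}} *
    {ffun K -> {bseq b of bool}}) :
  exists p : protocol X Y, cost p <= T * (2 * (b.+1 * #|K|)) + 1 /\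
    forall x y s,
      (forall v, s v = if alice v then sA' m.2 x v else sB' m.1 y v) ->
      run p x y = out (iter T (round (G x y)) s v0).
  by have [p ? ?] := IH (sA' m.2) (sB' m.1); exists p.
have /choice[p' p'P] (mA : {ffun K -> {bseq b of bool}}) :
  exists p' : protocol X Y,
    cost p' <= b.+1 * #|K| + (T * (2 * (b.+1 * #|K|)) + 1) /\
    forall x y, run p' x y = run (p (mA, outgoing cutB cutA (sB y))) x y.
  have [|p' ? ?] := bob_sends (fun y => outgoing cutB cutA (sB y))
    (cont := fun mB => p (mA, mB)) (card_messages K b)
    (c := T * (2 * (b.+1 * #|K|)) + 1); last by exists p'.
  by move=> mB; case: (pP (mA, mB)).
have [mA|p'' cp'' runp''] := alice_sends (fun x => outgoing cutA cutB (sA x))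
  (cont := p') (card_messages K b)
  (c := b.+1 * #|K| + (T * (2 * (b.+1 * #|K|)) + 1)).
  by case: (p'P mA).
exists p'' => [|x y s sE]; first lia.
have [_ runp'] := p'P (outgoing cutA cutB (sA x)); rewrite runp'' runp' iterSr.
have [_] := pP (outgoing cutA cutB (sA x), outgoing cutB cutA (sB y)).
by apply; exact: simulation_step.
Qed.

Lemma congest_simulation (r : 'I_n -> seed A) (T : nat) (v0 : 'I_n) :
    alice v0 ->
  exists2 p : protocol X Y, cost p <= T * (2 * (b.+1 * #|K|)) + 1 &
    forall x y, run p x y = out (exec (G x y) r T v0).
Proof.
move=> av0; have [p pc runp] := simulate T
  (fun x v => init v (nbA x v) (r v)) (fun y v => init v (nbB y v) (r v)) av0.
exists p => // x y; apply: runp => v.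
by case: ifPn => av; rewrite ?(nbAE x y av) ?(nbBE x y av).
Qed.

End Simulation.

(** * Gap networks *)

(** The surplus goes to [d0], the only value that may have several preimages. *)
Lemma padding (D : finType) (d0 : D) (n : nat) : #|D| <= n ->
  exists f : 'I_n -> D, (forall d, exists v, f v = d) /\
    (forall u v, f u = f v -> f u <> d0 -> u = v).
Proof.
rewrite cardE => Dn; exists (fun v : 'I_n => nth d0 (enum D) v).
split=> [d|u v fuv fu0].
  have dD : index d (enum D) < size (enum D) by rewrite index_mem mem_enum.
  by exists (Ordinal (leq_trans dD Dn)); rewrite /= nth_index // mem_enum.
have size_gt w : nth d0 (enum D) (nat_of_ord w) <> d0 -> w < size (enum D).
  by move=> fw; rewrite ltnNge; apply/negP => /(nth_default d0).
apply/val_inj/eqP; rewrite -(nth_uniq d0 _ _ (enum_uniq D)) ?size_gt -?fuv //.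
Qed.

Section GapNetwork.
Variables (I K : finType) (g q : nat) (ev : bool).
Hypothesis q_gt0 : 0 < q.
Local Notation V := (vertex I K).
Local Notation l := (g.*2.+1 + ev).

(** The surplus becomes twins of a hub, because twins of an end of a cut edge would multiply the
    edges across the cut. *)
Lemma vertex_labelling (n : nat) :
    #|I|.*2 * #|K|.+1 * (g + ev).+1 + #|K| * (g + q + g).+1 + 2 <= n ->
  exists f : 'I_n -> V,
    [/\ forall v, valid g q ev (f v),
        forall x, valid g q ev x -> exists v, f v = x &
        forall u v, f u = f v -> f u <> Hub false -> u = v].
Proof.
pose D := ((bool * I * option K * 'I_(g + ev).+1) +
           (K * 'I_(g + q + g).+1) + bool)%type.
pose dec (d : D) : V := match d with
  | inl (inl (s, i, o, t)) => Star s i o t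
  | inl (inr (k, x)) => Line k x
  | inr s => Hub s
  end.
have decI : injective dec.
  case=> [[[[[s i] o] t]|[k x]]|s]; case=> [[[[[s' i'] o'] t']|[k' x']]|s'] //=.
  - by case=> -> -> -> /val_inj ->.
  - by case=> -> /val_inj ->.
  - by case=> ->.
move=> Dn; have [|f [fonto finj]] := @padding D (inr false) n.
  by rewrite !card_sum !card_prod card_option !card_ord card_bool mul2n.
exists (dec \o f); split=> [v|x|u v] /=.
- by case: (f v) => [[[[[s i] o] t]|[k x]]|s] //=; rewrite -ltnS ltn_ord.
- case: x => [s i o t|k x|s] /= xv.
  + by have [v fv] := fonto (inl (inl (s, i, o, inord t))); exists v;
      rewrite fv /= inordK.
  + by have [v fv] := fonto (inl (inr (k, inord x))); exists v;
      rewrite fv /= inordK.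
  + by have [v fv] := fonto (inr s); exists v; rewrite fv.
- by move/decI => fuv fu; apply: finj => // fu0; apply: fu; rewrite fu0.
Qed.

(** The cut takes the first edge of each path of length [q], so the edges that depend on the input
    stay within one side. *)
Definition bob_side (u : V) : bool :=
  match u with Star s _ _ _ => s | Line _ x => g < x | Hub s => s end.

Lemma edge_local (S S' : bool -> I -> {set K}) (u v : V) :
  S (bob_side u) =1 S' (bob_side u) -> edge g q ev S u v = edge g q ev S' u v.
Proof.
case: u v => [s i o t|k x|s] [s' i' o' t'|k' x'|s'] //= SS';
  rewrite /edge /= ?SS' //.
congr [&& _, _ & _]; have [->|s'x] := eqVneq s' (g < x); first by rewrite SS'.
have -> : (x == coord_pos g q s') = false; last by rewrite !andbF.
by apply/negP => /eqP xE; case: s' s'x xE => /=; lia.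
Qed.

Lemma edge_cut (S : bool -> I -> {set K}) (u v : V) :
    edge g q ev S u v -> ~~ bob_side u -> bob_side v ->
  exists k, u = Line k g /\ v = Line k g.+1.
Proof.
case: u v => [s i o t|k x|s] [s' i' o' t'|k' x'|s'] /and3P[_ _] //=.
- by move=> + /negbTE sF s'T; rewrite sF s'T.
- by rewrite orbF => /and4P[_ _ /eqP-> _]; case: s => //=; rewrite ltnn.
- by move=> /and4P[_ _ /eqP-> _] + s'T; rewrite s'T /=; lia.
- rewrite -leqNgt => arcs xg x'g; suff [<- xE] : k = k' /\ x' = x.+1.
    by exists k; split; congr Line; lia.
  by case/orP: arcs => /orP[/andP[/eqP kk' /eqP xE]|/and4P[_ _ /eqP xE _]];
    [split|exfalso; lia..].
- by move=> /eqP-> + s'T; rewrite s'T /=; lia.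
- by rewrite orbF => /eqP-> /negbTE ->.
Qed.

Lemma gap_network_diameter (n D : nat) (f : 'I_n -> V)
    (S : bool -> I -> {set K}) (phi : V -> nat) (x y : V) :
    (forall v, valid g q ev (f v)) ->
    (forall x, valid g q ev x -> exists v, f v = x) -> 1 < D ->
    (forall u v, valid g q ev u -> valid g q ev v ->
       dist_le (edge g q ev S) D u v) ->
    (forall u v, valid g q ev u -> edge g q ev S u v -> phi v <= (phi u).+1) ->
    valid g q ev x -> valid g q ev y -> phi x + D <= phi y ->
  exists G : network n,
    adj G =2 (fun u v => edge g q ev S (f u) (f v)) /\ diameter G = D.
Proof.
move=> fvalid fonto D_gt1 leD lip xv yv gap.
(* A walk to a hub other than [u] must begin with an edge. *)
have not_isolated u : valid g q ev u -> exists v, edge g q ev S u v.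
  move=> uv; pose v : V := if u is Hub false then Hub true else Hub false.
  have vv : valid g q ev v by rewrite /v; case: (u) => // [] [].
  have [[|j] _ w] := leD u v uv vv; last by have [z] := walkS_inv w; exists z.
  by have := walk0_inv w; rewrite /v; case: (u) => // [] [].
exists (blowup (@edge_sym _ _ _ _ _ _) (@edge_irr _ _ _ _ _ _)
  (@edge_valid _ _ _ _ _ _) fvalid fonto not_isolated D_gt1 leD).
split=> //; apply/eqP; rewrite eqn_leq diameter_blowup_le /=.
rewrite -(leq_add2l (phi x)); apply: leq_trans gap _.
exact: diameter_blowup_ge.
Qed.

Lemma gap_network (n : nat) (f : 'I_n -> V) (S : bool -> I -> {set K})
    (k0 : K) (i0 : I) :
    (forall v, valid g q ev (f v)) ->
    (forall x, valid g q ev x -> exists v, f v = x) ->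
    (forall s i i', exists k, k \in S s i :&: S s i') ->
  exists G : network n, adj G =2 (fun u v => edge g q ev S (f u) (f v)) /\
    diameter G =
      if [exists i, exists j, [disjoint S false i & S true j]] then 3 * l + q
      else 2 * l + q.
Proof.
move=> fvalid fonto meet; case: ifPn => [/existsP[i /existsP[j ij]]|cross].
- apply: (gap_network_diameter (phi := far_potential g q ev S i j)
    (x := Star false i None (g + ev)) (y := Star true j None (g + ev))) => //.
  + by lia.
  + by move=> u v; apply: dist_le_gap => //; [lia|right].
  + by move=> u v; apply: far_potential_lipschitz.
  + exact: leqnn.
  + exact: leqnn.
  + by rewrite /= !eqxx /=; lia.
- apply: (gap_network_diameter (phi := near_potential g q ev)
    (x := Star false i0 None (g + ev)) (y := Star true i0 None (g + ev))) => //.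
  + by lia.
  + move=> u v; apply: dist_le_gap => //; left=> i j; apply/set0Pn.
    rewrite setI_eq0; apply: contra cross => ij.
    by apply/existsP; exists i; apply/existsP; exists j.
  + by move=> u v; apply: near_potential_lipschitz.
  + exact: leqnn.
  + exact: leqnn.
  + by rewrite /=; lia.
Qed.

End GapNetwork.

(** * Encoding set disjointness *)

Section Encoding.
Variable L : nat.
Local Notation I := {ffun 'I_L -> bool}.
Local Notation K := ('I_L * bool + bool)%type.

(* [codeword i] is contained in [codeword j] only if [i = j]; the last two
   coordinates make any two codewords meet, and any two complements. *)
Definition codeword (i : I) : {set K} :=
  [set k | match k with inl (t, b) => i t == b | inr b => b end]%SET.

(** A zero bit gives the full set, which meets every set of the other party. For two one bits,
    disjointness means that [codeword i] is contained in [codeword j], hence [i = j]. *)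
Definition coord_sets (x y : {ffun 'I_#|I| -> bool}) (s : bool) (i : I) :
    {set K} :=
  if s then if y (enum_rank i) then ~: codeword i else [set: K]%SET
  else if x (enum_rank i) then codeword i else [set: K]%SET.

Lemma coord_sets_meet (x y : {ffun 'I_#|I| -> bool}) (s : bool) (i j : I) :
  exists k, k \in coord_sets x y s i :&: coord_sets x y s j.
Proof.
by exists (inr (~~ s)); rewrite inE /coord_sets; case: s;
  do 2!case: ifP => _; rewrite !inE.
Qed.

Lemma coord_sets_disjoint (x y : {ffun 'I_#|I| -> bool}) :
  [exists i, exists j,
     [disjoint coord_sets x y false i & coord_sets x y true j]] = intersect x y.
Proof.
apply/existsP/existsP => [[i /existsP[j]]|[k /andP[xk yk]]]; last first.
  exists (enum_val k); apply/existsP; exists (enum_val k).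
  by rewrite /coord_sets enum_valK xk yk finset.disjoints_subset finset.setCK.
rewrite /coord_sets; case: ifP => xi; last first.
  move/disjointFr => /(_ (inr false)); rewrite inE => /(_ isT).
  by case: ifP => _; rewrite !inE.
case: ifP => yj; last first.
  by move/disjointFr => /(_ (inr true)); rewrite !inE => /(_ isT).
rewrite finset.disjoints_subset finset.setCK => /fintype.subsetP ij.
exists (enum_rank i); rewrite xi /=; suff -> : i = j by [].
apply/ffunP => t; have := ij (inl (t, i t)).
by rewrite !inE eqxx => /(_ isT) /eqP.
Qed.

End Encoding.

(** The output is negated because intersecting inputs give the larger diameter, for which a correct
    algorithm outputs [false]. *)
Lemma disjointness_protocol (L l q n b T : nat) (A : algorithm n b)
    (I : finType := {ffun 'I_L -> bool}) :
    0 < l -> 0 < q -> 10 * 2 ^ L * L.+1 * (l + q) <= n ->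
  exists G : {ffun 'I_#|I| -> bool} -> {ffun 'I_#|I| -> bool} -> network n,
    (forall x y, diameter (G x y) = if intersect x y then 3 * l + q
                                    else 2 * l + q) /\
    forall r : 'I_n -> seed A,
      exists2 p : protocol {ffun 'I_#|I| -> bool} {ffun 'I_#|I| -> bool},
        cost p <= T * (4 * (b.+1 * L.+1)) + 1 &
        exists v0, forall x y,
          run p x y = ~~ output (exec (G x y) r T v0).
Proof.
move=> l_gt0 q_gt0 sizeL.
pose K : finType := ('I_L * bool + bool)%type.
pose g := l.-1./2; pose ev := ~~ odd l.
have lE : g.*2.+1 + ev = l.
  by rewrite /g /ev; have := odd_double_half l.-1; case: (l) l_gt0 => //= m _;
    rewrite negbK; lia.
have cardI : #|I| = 2 ^ L by rewrite card_ffun card_ord card_bool.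
have cardK : #|K| = 2 * L.+1.
  by rewrite card_sum card_prod card_ord card_bool; lia.
have [f [fvalid fonto finj]] :
    exists f : 'I_n -> vertex I K,
    [/\ forall v, valid g q ev (f v),
        forall x, valid g q ev x -> exists v, f v = x &
        forall u v, f u = f v -> f u <> Hub false -> u = v].
  apply: vertex_labelling; apply: leq_trans sizeL; rewrite cardI cardK.
  have I_gt0 : 0 < 2 ^ L by rewrite expn_gt0.
  have m_gt0 : 0 < l + q by lia.
  have b1 : (g + ev).+1 <= l + q by lia.
  have b2 : (g + q + g).+1 <= l + q by lia.
  move: (2 ^ L) (l + q) I_gt0 m_gt0 b1 b2 => N m N0 m0 b1 b2.
  (* The factor 10 is 4 + 2 for the stars, 2 for the lines and 2 for the hubs. *)
  have c1 : N.*2 * (2 * L.+1).+1 * (g + ev).+1 <= N.*2 * (2 * L.+1).+1 * m.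
    by rewrite leq_mul2l b1 orbT.
  have c2 : 2 * L.+1 * (g + q + g).+1 <= 2 * L.+1 * m * N.
    by apply: leq_trans (leq_pmulr _ N0); rewrite leq_mul2l b2 orbT.
  have c3 : 2 <= 2 * (N * m) by nia.
  by nia.
have k0 : K := inr true; have i0 : I := [ffun=> true].
have /choice[G GP] (xy : {ffun 'I_#|I| -> bool} * {ffun 'I_#|I| -> bool}) :
    exists Gxy : network n,
      adj Gxy =2 (fun u v => edge g q ev (coord_sets xy.1 xy.2) (f u) (f v)) /\
      diameter Gxy = if intersect xy.1 xy.2 then 3 * l + q else 2 * l + q.
  rewrite -coord_sets_disjoint -lE.
  exact: gap_network (@coord_sets_meet L xy.1 xy.2).
exists (fun x y => G (x, y)); split=> [x y|r]; first by case: (GP (x, y)).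
have adjE x y : adj (G (x, y)) =2
    (fun u v => edge g q ev (coord_sets x y) (f u) (f v)).
  by case: (GP (x, y)).
pose alice v := ~~ bob_side g (f v).
have [v0 fv0] := fonto (Hub false) isT.
have /choice[cutA cutAE] (k : K) : exists v, f v = Line k g.
  by apply: fonto => /=; lia.
have /choice[cutB cutBE] (k : K) : exists v, f v = Line k g.+1.
  by apply: fonto => /=; lia.
(* The neighbors of Alice's vertices depend on [x] only, so [x] can stand in for Bob's input, and
   symmetrically. *)
have [||||p pc runp] := @congest_simulation _ _ n b A (fun s => ~~ output s)
  (fun x y => G (x, y)) alice (fun x => neighbors (G (x, x)))
  (fun y => neighbors (G (y, y))) _ _ K cutA cutB _ r T v0.
- move=> x y v av; apply/setP => w; rewrite !inE !adjE; apply: edge_local => //.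
  by rewrite (negbTE av).
- move=> x y v /negPn bv; apply/setP => w; rewrite !inE !adjE.
  by apply: edge_local => //; rewrite bv.
- move=> x y u v; rewrite adjE => uv au /negPn bv.
  have [k [fu fv]] := edge_cut q_gt0 uv au bv.
  by exists k; split; apply: finj; rewrite ?cutAE ?cutBE ?fu ?fv.
- by rewrite /alice fv0.
- exists p; last by exists v0.
  by apply: leq_trans pc _; rewrite cardK; nia.
Qed.

(** * The lower bound *)

Import Order.TTheory GRing.Theory Num.Theory.
Local Open Scope ring_scope.

Lemma holds_with_prob_sub d (Omega : measurableType d) (R : realType)
    (P : probability Omega R) (p : R) (E E' : set Omega) :
  (forall w, E w -> E' w) -> holds_with_prob P p E -> holds_with_prob P p E'.
Proof. by move=> EE' [F [mF FE PF]]; exists F; split=> // w /FE /EE'. Qed.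

(** Each seed yields one protocol, which is correct whenever all vertices are, so the error bound
    carries over. *)
Lemma distinguishes_disjointness (R : realType) (eps c0 : R) (N0 : nat)
    (hard : forall (N k : nat) (d : measure_display) (Omega : measurableType d)
         (P : probability Omega R)
         (p : Omega -> protocol {ffun 'I_N -> bool} {ffun 'I_N -> bool}),
      (N0 <= N)%N -> (forall w, (cost (p w) <= k)%N) ->
      (forall x y, holds_with_prob P (1 - eps)
                   [set w | run (p w) x y = intersect x y]) ->
      c0 * N%:R <= k%:R)
    (L l q n b T : nat) (A : algorithm n b) (d : measure_display)
    (Omega : measurableType d) (P : probability Omega R)
    (r : Omega -> 'I_n -> seed A) :
    (0 < l)%N -> (0 < q)%N -> (10 * 2 ^ L * L.+1 * (l + q) <= n)%N ->
    (N0 <= 2 ^ L)%N -> distinguishes P r T (2 * l + q) (3 * l + q) eps ->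
  c0 * (2 ^ L)%:R <= (T * (4 * (b.+1 * L.+1)) + 1)%:R.
Proof.
move=> l_gt0 q_gt0 sizeL LN0 dist.
have [G [diamG simG]] := disjointness_protocol T A l_gt0 q_gt0 sizeL.
have /choice[p pP] (w : Omega) : exists p,
    (cost p <= T * (4 * (b.+1 * L.+1)) + 1)%N /\
    exists v0, forall x y, run p x y = ~~ output (exec (G x y) (r w) T v0).
  by have [p ? ?] := simG (r w); exists p.
have cardI : #|{ffun 'I_L -> bool}| = (2 ^ L)%N.
  by rewrite card_ffun card_ord card_bool.
rewrite -cardI; apply: (@hard _ _ d Omega P p) => [|w|x y].
- by rewrite cardI.
- by case: (pP w).
- have promise : diameter (G x y) = (2 * l + q)%N \/
      diameter (G x y) = (3 * l + q)%N.
    by rewrite diamG; case: ifP; [right|left].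
  apply: holds_with_prob_sub (dist _ promise).
  move=> w /= outE; have [_ [v0 ->]] := pP w; rewrite outE diamG.
  case: ifP => _; last by rewrite eqxx.
  by rewrite eqn_add2r eqn_pmul2r.
Qed.

(** Take the largest feasible [L]. Failure at [L.+1] gives [40 = 10 * 2 * 2], since [2 ^ L] doubles
    and [L.+2 <= 2 * L.+1]. *)
Lemma optimal_size (m n L1 : nat)
    (f := fun L => (10 * 2 ^ L * L.+1 * m)%N) :
    (0 < m)%N -> (f L1 <= n)%N ->
  exists L, [/\ (L1 <= L)%N, (f L <= n)%N & (n <= 40 * 2 ^ L * L.+1 * m)%N].
Proof.
move=> m_gt0 fL1; have ex : exists L, (f L <= n)%N by exists L1.
have bound L : (f L <= n)%N -> (L <= n)%N.
  move=> fL; apply: leq_trans fL.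
  apply: leq_trans (ltnW (ltn_expl L (ltnSn 1))) _.
  by rewrite /f; nia.
case: (ex_maxnP ex bound) => L fL maxL; exists L; split=> //; first exact: maxL.
have : ~~ (f L.+1 <= n)%N by apply/negP => /maxL; rewrite ltnn.
by rewrite -ltnNge /f expnS; nia.
Qed.

Theorem corollary3p2 (R : realType)
    (disjointness_hard : disjointness_lower_bound R)
    (eps : R) (eps_lt_half : eps < 2^-1) (B : R) :
  exists2 c : R, 0 < c & exists C : nat,
  forall (l q n b T : nat) (A : algorithm n b)
         (d : measure_display) (Omega : measurableType d)
         (P : probability Omega R) (r : Omega -> 'I_n -> seed A),
    (1 <= l)%N -> (1 <= q)%N ->
    (C * (l + q) <= n)%N ->
    b%:R <= B * ln (n%:R : R) ->
    distinguishes P r T (2 * l + q) (3 * l + q) eps ->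
    c * (n%:R / ((l + q)%:R * ln (n%:R : R) ^+ 3)) <= T%:R.
Proof.
have [c0 c0_gt0 [N0 hard]] := disjointness_hard eps eps_lt_half.
pose a : R := ln 2; have a_gt0 : 0 < a by rewrite ln_gt0 ?ltr1n.
(* The term [a^-1] absorbs the additional 1 in [b.+1], as [ln n] is at least [a]. *)
pose B' := `|B| + a^-1; have B'_gt0 : 0 < B'.
  by rewrite ltr_wpDl ?normr_ge0 ?invr_gt0.
have [m c0m] : exists m : nat, c0^-1 < m%:R.
  by exists (Num.truncn c0^-1).+1; exact: truncnS_gt.
pose L1 := (m + N0)%N.
(* Here 200 is [40 * 5], with 40 from [optimal_size] and 5 from the cost of the protocol; [a ^+ 2]
   converts two factors [L.+1] into natural logarithms. *)
exists (c0 * a ^+ 2 / (200 * B')).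
  by rewrite divr_gt0 ?mulr_gt0 ?exprn_gt0.
exists (10 * 2 ^ L1 * L1.+1)%N.
move=> l q n b T A d Omega P r l_gt0 q_gt0 nC bB dist.
have lq_gt0 : (0 < l + q)%N by lia.
have [L [L1L sizeL nL]] := optimal_size lq_gt0 nC.
have L1_lt : (L1 < 2 ^ L)%N.
  by apply: leq_trans (ltn_expl L1 (ltnSn 1)) _; rewrite leq_pexp2l.
have N0L : (N0 <= 2 ^ L)%N by rewrite /L1 in L1_lt; lia.
have := distinguishes_disjointness hard l_gt0 q_gt0 sizeL N0L dist.
have c0L : 1 < c0 * (2 ^ L)%:R.
  rewrite -ltr_pdivrMl // mulr1; apply: lt_le_trans c0m _; rewrite ler_nat.
  by rewrite /L1 in L1_lt; lia.
(* For [T = 0] the cost is 1, below [c0 * 2 ^ L] by the choice of [m]; for [T > 0] the final bit is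
   absorbed by raising 4 to 5. *)
have [->|T_gt0 cost_ge] := posnP T; first by rewrite mul0n add0n; lra.
have {cost_ge} cost_ge : c0 * (2 ^ L)%:R <= (T * (5 * (b.+1 * L.+1)))%:R.
  by apply: le_trans cost_ge _; rewrite ler_nat; nia.
have n_gt0 : (0 < n)%N by apply: leq_trans sizeL; rewrite !muln_gt0 expn_gt0.
set x := ln (n%:R : R).
have La : L.+1%:R * a <= x.
  rewrite /x mulr_natl -lnXn // ler_ln ?posrE ?exprn_gt0 ?ltr0n //.
  rewrite -natrX ler_nat expnS; apply: leq_trans sizeL.
  by have := expn_gt0 2 L; nia.
have ax : a <= x by apply: le_trans La; rewrite ler_peMl ?ler1n // ltW.
have x_gt0 : 0 < x := lt_le_trans a_gt0 ax.
have bx : b.+1%:R <= B' * x.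
  rewrite -natr1 mulrDl lerD //.
    by apply: le_trans bB _; rewrite ler_wpM2r ?ler_norm // ltW.
  by rewrite mulrC ler_pdivlMr ?mul1r.
have nb : c0 * n%:R <= 200 * (l + q)%:R * T%:R * (L.+1%:R ^+ 2 * b.+1%:R).
  apply: (@le_trans _ _ (c0 * (40 * 2 ^ L * L.+1 * (l + q))%:R)).
    by rewrite ler_pM2l // ler_nat.
  have -> : c0 * (40 * 2 ^ L * L.+1 * (l + q))%:R =
      (40 * L.+1 * (l + q))%:R * (c0 * (2 ^ L)%:R) by rewrite !natrM; ring.
  apply: le_trans (ler_wpM2l (ler0n _ _) cost_ge) _.
  by rewrite !natrM; lra.
(* The three logarithms come from the number of vertices, the number of cut edges and the message
   size. *)
have xb : L.+1%:R ^+ 2 * b.+1%:R * a ^+ 2 <= B' * x ^+ 3.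
  have -> : L.+1%:R ^+ 2 * b.+1%:R * a ^+ 2 = b.+1%:R * (L.+1%:R * a) ^+ 2 :> R.
    by ring.
  have -> : B' * x ^+ 3 = (B' * x) * x ^+ 2 by ring.
  have La_ge0 : 0 <= L.+1%:R * a by rewrite mulr_ge0 // ltW.
  apply: ler_pM => //; first exact: exprn_ge0.
  by rewrite ler_pXn2r // nnegrE ltW.
have lqx_gt0 : 0 < (l + q)%:R * x ^+ 3 by rewrite mulr_gt0 ?exprn_gt0 ?ltr0n.
rewrite mulrA ler_pdivrMr // mulrAC ler_pdivrMr ?mulr_gt0 //.
have -> : c0 * a ^+ 2 * n%:R = c0 * n%:R * a ^+ 2 by ring.
apply: le_trans (ler_wpM2r (exprn_ge0 2 (ltW a_gt0)) nb) _.
have -> : T%:R * ((l + q)%:R * x ^+ 3) * (200 * B') =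
  200 * (l + q)%:R * T%:R * (B' * x ^+ 3) by ring.
by rewrite -[leLHS]mulrA ler_wpM2l // !mulr_ge0.
Qed.
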